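(* Let $G$ and $H$ be connected graphs with $n(G)\ge 2$ and $n(H)\ge 2$, and let at least one of the following two conditions hold: (i) $o(H)=\mathcal{R}$ and $\mathrm{diam}(H)\le 2$; (ii) $o(K_1\odot H)=\mathcal{R}$. Then $o(G\odot H)=\mathcal{R}$.
   Context: All graphs are finite and simple; $n(X)=|V(X)|$, $K_1$ is the one-vertex graph, and $\mathrm{diam}(X)$ is the largest shortest-path distance between two vertices of $X$. The corona product $G\odot H$ of a connected graph $G$ and a graph $H$ is obtained from one copy of $G$ and $n(G)$ disjoint copies of $H$ by joining the $i$-th vertex of $G$ to every vertex of the $i$-th copy of $H$. A set $W\subseteq V(X)$ of a connected graph $X$ is a resolving set of $X$ if for every two distinct vertices $x,y$ of $X$ there is $z\in W$ such that the shortest-path distances $d_X(x,z)$ and $d_X(y,z)$ differ. The Maker-Breaker resolving game on a connected graph $X$ is played by two players, Resolver and Spoiler, who alternately select a not yet played vertex of $X$. Resolver wins if he selects all the vertices of some resolving set of $X$; Spoiler wins if she prevents this, i.e. if she selects at least one vertex from every resolving set of $X$. The outcome $o(X)$ is: $\mathcal{R}$ if Resolver has a winning strategy no matter who starts the game; $\mathcal{S}$ if Spoiler has a winning strategy no matter who starts the game; $\mathcal{N}$ if the first player has a winning strategy (no matter which of the two players that is). *)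

(* Defs.v *)
From mathcomp Require Import all_boot.

Set Implicit Arguments.
Unset Strict Implicit.
Unset Printing Implicit Defensive.

Record sgraph := SGraph {
  vertex :> finType;
  adj : rel vertex;
  adj_sym : symmetric adj;
  adj_irr : irreflexive adj
}.

Definition connected (X : sgraph) : Prop :=
  forall x y : X, connect (@adj X) x y.

Definition walk_of_length (X : sgraph) (x y : X) (k : nat) : bool :=
  [exists p : k.-tuple X, path (@adj X) x p && (last x p == y)].

(* The least length of a walk from x to y: a shortest path has fewer than #|X|
   edges, and [find] over iota 0 n returns the least k < n satisfying the
   predicate.  Vertices in different components get the junk value #|X|. *)
Definition dist (X : sgraph) (x y : X) : nat :=
  find (walk_of_length x y) (iota 0 #|X|).

Definition diam (X : sgraph) : nat :=
  \max_(x : X) \max_(y : X) dist x y.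

Definition K1_adj : rel unit := fun _ _ => false.

Lemma K1_sym : symmetric K1_adj. Proof. by []. Qed.

Lemma K1_irr : irreflexive K1_adj. Proof. by []. Qed.

Definition K1 : sgraph := SGraph K1_sym K1_irr.

(* inl g is the vertex g of G; inr (g, h) is the vertex h of the copy of H
   attached to g. *)
Definition corona_adj (G H : sgraph) : rel (G + G * H)%type :=
  fun u v =>
    match u, v with
    | inl g, inl g' => adj g g'
    | inl g, inr (g', _) => g == g'
    | inr (g, _), inl g' => g == g'
    | inr (g, h), inr (g', h') => (g == g') && adj h h'
    end.

Lemma corona_sym (G H : sgraph) : symmetric (@corona_adj G H).
Proof.
by move=> [g|[g h]] [g'|[g' h']] /=; rewrite ?[adj g _]adj_sym ?[adj h _]adj_sym
  ?[g == _]eq_sym.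
Qed.

Lemma corona_irr (G H : sgraph) : irreflexive (@corona_adj G H).
Proof. by move=> [g|[g h]] /=; rewrite adj_irr ?andbF. Qed.

Definition corona (G H : sgraph) : sgraph :=
  SGraph (@corona_sym G H) (@corona_irr G H).

Definition resolving (X : sgraph) (W : {set X}) : Prop :=
  forall x y : X, x != y -> exists2 z, z \in W & dist x z != dist y z.

Inductive player := Resolver | Spoiler.

Definition opponent (p : player) : player :=
  match p with Resolver => Spoiler | Spoiler => Resolver end.

(* The player making move number k (counted from 0). *)
Definition mover (first : player) (k : nat) : player :=
  if odd k then opponent first else first.

(* A history is the sequence of vertices played so far, oldest first; a play is
   a history in which every vertex has been played exactly once.  Playing on
   until no vertex is left is harmless, since a player who has already won
   remains the winner. *)
Definition is_play (X : sgraph) (pl : seq X) : Prop := perm_eq pl (enum X).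

Definition selected (X : sgraph) (first p : player) (pl : seq X) (x : X) :=
  exists h t, pl = h ++ x :: t /\ mover first (size h) = p.

Definition won_by (X : sgraph) (first p : player) (pl : seq X) : Prop :=
  match p with
  | Resolver => exists2 W : {set X}, resolving W &
      forall x, x \in W -> selected first Resolver pl x
  | Spoiler => forall W : {set X}, resolving W ->
      exists2 x, x \in W & selected first Spoiler pl x
  end.

Definition strategy (X : sgraph) := seq X -> X.

(* Without legality, a strategy proposing already played vertices would be
   followed by no play and hence win vacuously. *)
Definition legal (X : sgraph) (s : strategy X) : Prop :=
  forall h : seq X, (exists x, x \notin h) -> s h \notin h.

Definition follows (X : sgraph) (first p : player) (s : strategy X)
    (pl : seq X) : Prop :=
  forall h x t, pl = h ++ x :: t -> mover first (size h) = p -> x = s h.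

Definition has_winning_strategy (X : sgraph) (first p : player) : Prop :=
  exists2 s : strategy X, legal s &
    forall pl : seq X, is_play pl -> follows first p s pl ->
      won_by first p pl.

Inductive outcome := outcomeR | outcomeS | outcomeN.

(* o(X) = o, as a relation. *)
Definition has_outcome (X : sgraph) (o : outcome) : Prop :=
  match o with
  | outcomeR => forall first, has_winning_strategy X first Resolver
  | outcomeS => forall first, has_winning_strategy X first Spoiler
  | outcomeN => forall first, has_winning_strategy X first first
  end.

(* Main.v *)
(** Every vertex outside the [g]-th copy of [H] other than its root sees that
    copy only through [g].  Hence, as soon as [G] has two vertices, a set
    resolves [G ⊙ H] when its trace on each copy of [H] separates the vertices
    of that copy by the distance truncated at [2].  Under either hypothesis
    Resolver, moving second on a single copy, can select such a trace; he wins
    on [G ⊙ H] by answering every move of Spoiler in the copy where it was made,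
    since additional moves never hurt him. *)

Require Import Defs.
From mathcomp Require Import all_boot.
From Stdlib Require Import Classical ClassicalEpsilon.

Set Implicit Arguments.
Unset Strict Implicit.
Unset Printing Implicit Defensive.

(** * Maker-Breaker games as invariants *)

Section MakerBreaker.

Variable T : finType.
Implicit Types (P : {set T} -> Prop) (Q : {set T} -> {set T} -> Prop).

(* Maker is to move and owns [M]; he may also pass. *)
Definition answerable Q (M B : {set T}) : Prop :=
  Q M B \/ exists2 y, y \notin B & Q (y |: M) B.

(* [Q M B] reads: Maker owns [M], Breaker owns [B], Breaker is to move, and
   Maker wins. *)
Record maker_invariant P Q : Prop := MakerInvariant {
  inv_start : Q set0 set0;
  inv_mono : forall M M' B : {set T}, M \subset M' -> Q M B -> Q M' B;
  inv_end : forall M B, Q M B -> M :|: B = [set: T] -> P M;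
  inv_reply : forall M B x, Q M B -> x \notin M -> x \notin B ->
    answerable Q M (x |: B)
}.

Definition maker_wins P : Prop := exists Q, maker_invariant P Q.

End MakerBreaker.

Lemma maker_wins_weaken (T : finType) (P P' : {set T} -> Prop) :
  (forall M, P M -> P' M) -> maker_wins P -> maker_wins P'.
Proof.
move=> PP' [Q [Q0 Qm Qe Qr]]; exists Q; split=> // M B QMB MB.
by apply: PP'; apply: Qe MB.
Qed.

(* The vertices outside the sub-board are handed to Maker in advance. *)
Lemma maker_wins_subboard (S T : finType) (f : S -> T) (P : {set T} -> Prop) :
  injective f -> maker_wins P ->
  maker_wins (fun M : {set S} => P (f @: M :|: ~: (f @: setT))).
Proof.
move=> finj [Q [Q0 Qm Qe Qr]].
pose r := ~: (f @: [set: S]).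
have rf x : (f x \in r) = false by rewrite inE imset_f.
exists (fun M B : {set S} => Q (f @: M :|: r) (f @: B)); split.
- by rewrite [X in Q _ X]imset0; apply: Qm (sub0set _) Q0.
- by move=> M M' B sub; apply: Qm; rewrite setSU ?imsetS.
- move=> M B QMB MB; apply: Qe QMB _; apply/setP=> t; rewrite !inE.
  case: (boolP (t \in f @: setT)) => [/imsetP[x _ ->]|]; last by rewrite orbT.
  by rewrite !mem_imset //= orbF -in_setU MB inE.
move=> M B x QMB xM xB.
have := Qr _ _ (f x) QMB; rewrite in_setU rf orbF !mem_imset // => /(_ xM xB).
rewrite -imsetU1 => -[Qp|[y yB Qy]]; first by left.
case: (boolP (y \in f @: setT)) => [/imsetP[z _ yz]|ny].
  right; exists z; first by move: yB; rewrite yz mem_imset.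
  by rewrite imsetU1 -setUA -yz.
(* A reply outside the sub-board is a vertex Maker already owns, so on the sub-board it counts as a
   pass. *)
left; apply: Qm Qy; apply/subsetP=> t /setU1P[->|//].
by rewrite !inE ny orbT.
Qed.

(* Maker answers each move in the board where it was made. *)
Lemma maker_wins_product (I S T : finType) (f : I -> S -> T)
    (P : {set S} -> Prop) :
  injective (fun u : I * S => f u.1 u.2) -> maker_wins P ->
  maker_wins (fun M : {set T} => forall i, P (f i @^-1: M)).
Proof.
move=> finj [Q [Q0 Qm Qe Qr]].
have fE i j s t : (f i s == f j t) = (i == j) && (s == t).
  by apply/eqP/andP => [/(finj (i, s) (j, t))[-> ->]|[/eqP-> /eqP->]].
pose tr i (M : {set T}) := f i @^-1: M.
have tr_same i s M : tr i (f i s |: M) = s |: tr i M.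
  by apply/setP=> t; rewrite !inE fE eqxx.
have tr_other i j s M : i != j -> tr i (f j s |: M) = tr i M.
  by move=> ij; apply/setP=> t; rewrite !inE fE (negPf ij).
exists (fun M B => forall i, Q (tr i M) (tr i B)); split.
- by move=> i; rewrite [tr i _]preimset0.
- by move=> M M' B sub QMB i; apply: Qm (QMB i); apply: preimsetS.
- move=> M B QMB MB i; apply: (Qe _ _ (QMB i)).
  by rewrite /tr -preimsetU MB; apply/setP=> s; rewrite !inE.
move=> M B x QMB xM xB.
(* A move outside all the boards changes none of the traces, and Maker passes. *)
case: (boolP [exists i, exists s, x == f i s]); last first.
  move=> /existsPn nx; left=> i; suff -> : tr i (x |: B) = tr i B by [].
  apply/setP=> s; rewrite !inE; case: eqP => //= fx.
  by case/existsP: (nx i); exists s; rewrite fx.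
case/existsP=> i /existsP[s /eqP xE]; rewrite {x}xE in xM xB *.
have [||Qp|[y yB Qy]] := Qr _ _ s (QMB i); rewrite ?inE //.
- left=> j; case: (eqVneq j i) => [->|ji]; first by rewrite tr_same.
  by rewrite tr_other.
right; exists (f i y); first by move: yB; rewrite !inE fE eqxx.
move=> j; case: (eqVneq j i) => [->|ji]; first by rewrite !tr_same.
by rewrite !tr_other.
Qed.

(** * Strategies and invariants *)

Section Taken.

Variable T : finType.

(** In a history without repetition [index x h] is the number of the move that selected [x], so each
    parity collects the vertices of one player. *)
Definition taken (b : bool) (h : seq T) : {set T} :=
  [set x in h | odd (index x h) == b].

Lemma taken_nil b : taken b [::] = set0.
Proof. by apply/setP=> x; rewrite !inE. Qed.

Lemma taken_rcons b h x : x \notin h ->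
  taken b (rcons h x) =
    if odd (size h) == b then x |: taken b h else taken b h.
Proof.
move=> xh; apply/setP=> z.
have -> : (z \in taken b (rcons h x)) =
    (z == x) && (odd (size h) == b) || (z \in taken b h).
  rewrite !inE mem_rcons in_cons -cats1 index_cat.
  case: (eqVneq z x) => [->|_] /=; last by case: (z \in h).
  by rewrite (negPf xh) /= eqxx addn0 orbF.
by case: (odd _ == b); rewrite ?andbT ?andbF // !inE.
Qed.

Lemma mem_taken b h x : x \in taken b h -> x \in h.
Proof. by rewrite inE => /andP[]. Qed.

Lemma taken_full b h : h =i T -> taken b h :|: taken (~~ b) h = [set: T].
Proof. by move=> hT; apply/setP=> x; rewrite !inE hT; case: odd b => -[]. Qed.

Lemma taken_disjoint b h x : x \in taken b h -> x \notin taken (~~ b) h.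
Proof. by rewrite !inE => /andP[-> /eqP->]; case: b. Qed.

End Taken.

Definition resolver_parity (first : player) : bool :=
  if first is Spoiler then true else false.

Lemma moverE first k : mover first k =
  if odd k == resolver_parity first then Resolver else Spoiler.
Proof. by rewrite /mover; case: first; case: odd. Qed.

Lemma selectedP (X : sgraph) first (pl : seq X) x : uniq pl ->
  selected first Resolver pl x <-> x \in taken (resolver_parity first) pl.
Proof.
move=> Upl; split=> [[h [t [plE]]]|].
  rewrite moverE; case: ifP => // par _; move: Upl.
  rewrite plE cat_uniq inE index_cat mem_cat mem_head orbT /= eqxx addn0.
  by case/and3P=> _ /norP[/negPf-> _] _; rewrite par.
rewrite inE => /andP[xpl]; case/splitPr: xpl Upl => h t.
rewrite cat_uniq index_cat /= eqxx addn0 => /and3P[_ /norP[/negPf-> _] _].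
by move=> par; exists h, t; rewrite moverE par.
Qed.

Lemma resolving_mono (X : sgraph) (W W' : {set X}) :
  W \subset W' -> resolving W -> resolving W'.
Proof.
move=> sub resW x y /resW[z zW dz].
by exists z => //; apply: (subsetP sub).
Qed.

Lemma follows_rcons (X : sgraph) first p (s : strategy X) h x :
  follows first p s (rcons h x) <->
  follows first p s h /\ (mover first (size h) = p -> x = s h).
Proof.
split=> [fol|[fol folx] h' y t].
  split=> [h' y t hE|]; last by apply: (fol h x [::]); rewrite cats1.
  by apply: (fol h' y (rcons t x)); rewrite hE rcons_cat.
case/lastP: t => [|t z]; first by rewrite cats1 => /rcons_inj[<- <-].
by rewrite -rcons_cons -rcons_cat => /rcons_inj[/fol].
Qed.

Lemma uniq_play (X : sgraph) (pl : seq X) : uniq pl -> pl =i X -> is_play pl.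
Proof.
by move=> U plX; apply: uniq_perm; rewrite ?enum_uniq // => x; rewrite mem_enum plX.
Qed.

Lemma full_or_free (X : finType) (h : seq X) :
  h =i X \/ exists x, x \notin h.
Proof.
case: (pickP [pred x | x \notin h]) => [x xh|full]; first by right; exists x.
by left=> x; have /negbFE -> := full x.
Qed.

(** Winning is defined on complete plays only; this makes a winning strategy usable at an
    intermediate position. *)
Lemma follows_extend (X : sgraph) first p (s : strategy X) h :
  legal s -> uniq h -> follows first p s h ->
  exists t, is_play (h ++ t) /\ follows first p s (h ++ t).
Proof.
move=> leg; have [n] := ubnP (#|X| - size h).
elim: n h => // n IHn h; rewrite ltnS => hn Uh fol.
case: (full_or_free h) => [full|free].
  by exists [::]; rewrite cats0; split=> //; apply: uniq_play.
have [x xh folx] : exists2 x, x \notin h & mover first (size h) = p -> x = s h.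
  case: (classic (mover first (size h) = p)) => mp; first by exists (s h); auto.
  by case: free => x; exists x.
have Uhx : uniq (rcons h x) by rewrite rcons_uniq xh.
have lt_h : size (rcons h x) <= #|X| by rewrite -(card_uniqP Uhx) max_card.
rewrite size_rcons in lt_h.
have [||t [plt folt]] := IHn (rcons h x) _ Uhx.
- by rewrite size_rcons; apply: leq_trans hn; rewrite ltn_sub2l.
- exact/follows_rcons.
by exists (x :: t); rewrite -cat_rcons.
Qed.

(** A position counts as won when some history consistent with [s] gives Spoiler exactly [B] and
    Resolver at most [M]. Mere inclusion in [M] makes the invariant monotone. *)
Lemma strategy_maker_wins (X : sgraph) :
  has_winning_strategy X Spoiler Resolver -> maker_wins (@resolving X).
Proof.
case=> s leg win.
(* Spoiler moves at even lengths. The alternative [h =i X] covers boards of odd size, where she also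
   makes the last move. *)
pose Q (M B : {set X}) := exists h : seq X,
  [/\ uniq h, follows Spoiler Resolver s h, ~~ odd (size h) \/ h =i X,
      taken true h \subset M & taken false h = B].
exists Q; split.
- exists [::]; rewrite !taken_nil sub0set; split=> //; last by left.
  by move=> [].
- move=> M M' B sub [h [Uh fol fin hM hB]]; exists h; split=> //.
  exact: subset_trans sub.
- move=> M B [h [Uh fol _ hM hB]] MB.
  have [t [pl folt]] := follows_extend leg Uh fol.
  have [W resW selW] := win _ pl folt.
  have Uht : uniq (h ++ t) by rewrite (perm_uniq pl) enum_uniq.
  apply: resolving_mono resW; apply/subsetP=> x /selW/(selectedP _ _ Uht) xht.
  (* A vertex outside [M] lies in [B], so Spoiler took it within [h] and Resolver cannot have it in
     the extended play. *)
  have: x \in M :|: B by rewrite MB inE.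
  case/setUP=> //; rewrite -hB => xh.
  have := taken_disjoint xht; rewrite inE mem_cat (mem_taken xh) index_cat.
  by rewrite (mem_taken xh); move: xh; rewrite inE => /andP[_ ->].
move=> M B x [h [Uh fol fin hM hB]] xM xB.
have xh : x \notin h.
  apply: contraNN xM => xh; apply: (subsetP hM).
  by move: xB; rewrite -hB !inE xh; case: odd.
have even_h : odd (size h) = false.
  by case: fin => [/negPf//|hX]; rewrite hX in xh.
have Uhx : uniq (rcons h x) by rewrite rcons_uniq xh.
have folx : follows Spoiler Resolver s (rcons h x).
  by apply/follows_rcons; split=> //; rewrite moverE even_h.
have takT : taken true (rcons h x) = taken true h by rewrite taken_rcons // even_h.
have takF : taken false (rcons h x) = x |: B by rewrite taken_rcons // even_h hB.
case: (full_or_free (rcons h x)) => [full|/leg].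
  by left; exists (rcons h x); split=> //; [right | rewrite takT].
set y := s _ => yh; right; exists y.
  by apply: contra yh; rewrite -takF; apply: mem_taken.
exists (rcons (rcons h x) y); rewrite ?rcons_uniq ?yh ?size_rcons /= even_h.
rewrite !taken_rcons // ?rcons_uniq ?xh ?size_rcons /= ?even_h /=.
split=> //; [exact/follows_rcons|by left|exact: setUS|by rewrite hB].
Qed.

(** Resolver plays a free vertex that restores [Q] whenever one exists. If he starts, his first move
    is an extra one, which the right to pass in [answerable] absorbs. *)
Lemma maker_wins_strategy (X : sgraph) (x0 : X) first :
  maker_wins (@resolving X) -> has_winning_strategy X first Resolver.
Proof.
case=> Q [Q0 Qm Qe Qr].
pose b := resolver_parity first.
pose good h y := Q (y |: taken b h) (taken (~~ b) h).
(* Legality concerns every history, so a free vertex is required even where no good reply exists. *)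
pose move_spec (h : seq X) y :=
  y \notin h /\ ((exists2 z, z \notin h & good h z) -> good h y).
pose s h := epsilon (inhabits x0) (move_spec h).
have sP h : (exists x, x \notin h) -> move_spec h (s h).
  case=> x xh; apply: epsilon_spec.
  case: (classic (exists2 z, z \notin h & good h z)) => [[z zh gz]|no].
    by exists z.
  by exists x.
exists s => [h /sP[]//|pl play fol].
have Upl : uniq pl by rewrite (perm_uniq play) enum_uniq.
have plX : pl =i X by move=> x; rewrite (perm_mem play) mem_enum.
suff ans : answerable Q (taken b pl) (taken (~~ b) pl).
  exists (taken b pl) => [|x]; last by move/(selectedP _ _ Upl).
  have full := taken_full b plX; case: ans => [/Qe|[y yB]]; first exact.
  (* On a full board a vertex that is not Spoiler's is already Resolver's, so adding it changes
     nothing. *)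
  have yM : y \in taken b pl.
    by have: y \in [set: X] by []; rewrite -full => /setUP[]// yB'; rewrite yB' in yB.
  have -> : y |: taken b pl = taken b pl by apply/setUidPr; rewrite sub1set.
  by move/Qe; apply.
have step : if odd (size pl) == b
    then answerable Q (taken b pl) (taken (~~ b) pl)
    else Q (taken b pl) (taken (~~ b) pl).
  move: Upl fol; clear play plX; elim/last_ind: pl => [|h x IHh].
    by rewrite !taken_nil /=; case: ifP => _; [left|].
  rewrite rcons_uniq => /andP[xh Uh] /follows_rcons[fol folx].
  have {IHh} := IHh Uh fol; rewrite moverE -/b in folx.
  rewrite size_rcons /= !taken_rcons //.
  have -> : (odd (size h) == ~~ b) = ~~ (odd (size h) == b) by case: odd (b) => -[].
  have -> : (~~ odd (size h) == b) = ~~ (odd (size h) == b) by case: odd (b) => -[].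
  case: ifP folx => /= [_ /(_ erefl) xE ans|_ _ QMB]; last first.
    by apply: Qr QMB _ _; apply: contra xh; apply: mem_taken.
  have [_ best] := sP h (ex_intro _ x xh); rewrite -xE in best.
  (* A pass, or a reply [y] already owned by Resolver, can be replaced by the free vertex [x], by
     monotonicity. *)
  apply: best; case: ans => [QMB|[y yB Qy]].
    by exists x => //; apply: Qm QMB; apply: subsetU1.
  case: (boolP (y \in h)) => [yh|]; last by exists y.
  have yM : y \in taken b h by move: yB; rewrite !inE yh /=; case: odd (b) => -[].
  exists x => //; apply: Qm Qy; apply/subsetP=> z.
  by rewrite !in_setU1 => /predU1P[->|->]; rewrite ?yM orbT.
by move: step; case: ifP => // _; left.
Qed.

(** * Distances *)

Section Distance.

Variable X : sgraph.
Implicit Types x y z : X.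

Lemma walk_path x p : path (@adj X) x p -> walk_of_length x (last x p) (size p).
Proof. by move=> xp; apply/existsP; exists (in_tuple p); rewrite xp eqxx. Qed.

Lemma dist_path x p : path (@adj X) x p -> dist x (last x p) <= size p.
Proof.
move=> xp; rewrite /dist; set a := walk_of_length _ _.
(* [find] never exceeds the length [#|X|] of the list, which settles long paths. *)
have [lt_p|le_X] := ltnP (size p) #|X|; last first.
  by apply: leq_trans le_X; rewrite -{2}(size_iota 0 #|X|) find_size.
rewrite leqNgt; apply/negP=> /(before_find 0).
by rewrite nth_iota // add0n /a walk_path.
Qed.

(** In a connected graph this is the minimum of the distance and 2. It is also the distance within a
    copy of [X] in a corona, where the root joins any two vertices. *)
Definition tdist x y : nat := if x == y then 0 else if adj x y then 1 else 2.

Hypothesis connX : connected X.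

Lemma dist_geodesic x y :
  exists p, [/\ path (@adj X) x p, last x p = y & size p = dist x y].
Proof.
have [p xp ->] := connectP (connX x y).
case/shortenP: xp => q xq Uq _ {p}.
(* A path without repeated vertices is short enough for [find] to reach its length. *)
have lt_q : size q < #|X| by rewrite -[(size q).+1](card_uniqP Uq) max_card.
have hasw : has (walk_of_length x (last x q)) (iota 0 #|X|).
  by apply/hasP; exists (size q); rewrite ?mem_iota ?walk_path.
have := nth_find 0 hasw; rewrite nth_iota; last by move: hasw; rewrite has_find size_iota.
case/existsP=> w /andP[xw /eqP wy]; exists w.
by rewrite size_tuple.
Qed.

Lemma dist_gt0 x y : x != y -> 0 < dist x y.
Proof. by have [[|z p] [_ <- <-]] := dist_geodesic x y; rewrite ?eqxx. Qed.

Lemma dist_gt1 x y : x != y -> ~~ adj x y -> 1 < dist x y.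
Proof.
have [[|z [|t p]] [/= xp <- <-]] := dist_geodesic x y; rewrite ?eqxx //.
by case/andP: xp => ->.
Qed.

Lemma dist_le2 x y : dist x y <= 2 -> dist x y = tdist x y.
Proof.
rewrite /tdist => d2; case: eqP => [<-|/eqP xy].
  by apply/eqP; rewrite -leqn0; apply: (@dist_path x [::]).
apply/eqP; rewrite eqn_leq; case: ifP => [axy|/negbT naxy].
  by rewrite dist_gt0 // andbT; apply: (@dist_path x [:: y]); rewrite /= axy.
by rewrite d2 dist_gt1.
Qed.

Lemma dist_diam x y : dist x y <= diam X.
Proof.
by rewrite /diam; apply: leq_trans (leq_bigmax x); apply: (leq_bigmax y).
Qed.

(** Known as adjacency resolving sets. *)
Definition adj_resolving (W : {set X}) : Prop :=
  forall x y, x != y -> exists2 z, z \in W & tdist x z != tdist y z.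

Lemma resolving_adj (W : {set X}) :
  diam X <= 2 -> resolving W -> adj_resolving W.
Proof.
move=> d2 resW x y /resW[z zW dz]; exists z => //.
by rewrite -!dist_le2 ?(leq_trans (dist_diam _ _) d2).
Qed.

End Distance.

(** * Distances and resolving sets in the corona product *)

Section Corona.

Variables G H : sgraph.
Hypothesis connG : connected G.

Local Notation X := (corona G H).
Local Notation root g := (inl g : X).
Local Notation leaf g h := (inr (g, h) : X).

Lemma corona_connected : connected X.
Proof.
have connrr g g' : connect (@adj X) (root g) (root g').
  have [p gp ->] := connectP (connG g g').
  elim: p g gp => [|g1 p IHp] g //= /andP[gg1 /IHp].
  by apply: connect_trans; apply: connect1.
have connrl g h : connect (@adj X) (root g) (leaf g h).
  by apply: connect1; rewrite /= eqxx.
have connlr g h : connect (@adj X) (leaf g h) (root g).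
  by apply: connect1; rewrite /= eqxx.
move=> [g|[g h]] [g'|[g' h']] //.
- exact: connect_trans (connrr g g') (connrl _ _).
- exact: connect_trans (connlr _ _) (connrr g g').
- exact: connect_trans (connlr _ _) (connect_trans (connrr g g') (connrl _ _)).
Qed.

Lemma dist_leaf_same g h h' : dist (leaf g h) (leaf g h') = tdist h h'.
Proof.
rewrite dist_le2.
- rewrite /tdist /= eqxx /=; congr (if _ then _ else _).
  by apply/eqP/eqP => [[->]|->].
- exact: corona_connected.
by apply: (@dist_path X _ [:: root g; leaf g h']); rewrite /= eqxx.
Qed.

Lemma dist_leaf_root g h : dist (leaf g h) (root g) = 1.
Proof.
rewrite dist_le2 /tdist /= ?eqxx //; first exact: corona_connected.
by apply: leqW; apply: (@dist_path X _ [:: root g]); rewrite /= eqxx.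
Qed.

Lemma dist_root_leaf g h : dist (root g) (leaf g h) = 1.
Proof.
rewrite dist_le2 /tdist /= ?eqxx //; first exact: corona_connected.
by apply: leqW; apply: (@dist_path X _ [:: leaf g h]); rewrite /= eqxx.
Qed.

(** The only way out of a copy is its root, so [q] is what remains of [p] after its first visit to
    [root g]. *)
Lemma path_leaf_root g h (p : seq X) :
  path (@adj X) (leaf g h) p -> (forall h', last (leaf g h) p != leaf g h') ->
  exists q, [/\ path (@adj X) (root g) q, last (root g) q = last (leaf g h) p
              & size q < size p].
Proof.
elim: p h => [|[g1|[g1 h1]] p IHp] h /=; first by move=> _ /(_ h) /eqP.
  by case/andP=> /eqP<- gp _; exists p.
case/andP=> /andP[/eqP<- _] gp /(IHp _ gp)[q [gq qE lt_q]].
by exists q; split=> //; apply: leqW.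
Qed.

Lemma dist_root_lt g h (w : X) : (forall h', w != leaf g h') ->
  dist (root g) w < dist (leaf g h) w.
Proof.
move=> wg; have [p [gp pw <-]] := dist_geodesic corona_connected (leaf g h) w.
have [|q [gq qE]] := path_leaf_root gp; first by rewrite pw.
by apply: leq_trans; rewrite -pw -qE ltnS dist_path.
Qed.

Lemma dist_root_leaf_gt1 g g' h : g != g' -> 1 < dist (root g) (leaf g' h).
Proof. by move=> gg'; apply: dist_gt1 => //; apply: corona_connected. Qed.

Lemma dist_leaf_leaf_gt2 g g' h h' :
  g != g' -> 2 < dist (leaf g h) (leaf g' h').
Proof.
move=> gg'; apply: leq_ltn_trans (dist_root_leaf_gt1 h' gg') (dist_root_lt _ _).
by move=> h1; apply: contra_neq gg' => -[->].
Qed.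

Hypotheses (nG : 1 < #|G|) (nH : 1 < #|H|).

(** Since [H] has two vertices, [W] meets every copy. Two leaves of one copy are separated inside
    it; a root and a leaf of its own copy, by a leaf of another copy. In each remaining pair the
    vertices belong to different roots, and a leaf of [W] in the copy of one of them is strictly
    closer to that one. *)
Lemma corona_resolving (W : {set X}) :
  (forall g, adj_resolving [set h | leaf g h \in W]) -> resolving W.
Proof.
move=> resW.
have other (g : G) : exists g', g' != g.
  have /card_gt1P[x [y [_ _ xy]]] := nG.
  case: (eqVneq x g) => [<-|xg]; last by exists x.
  by exists y; rewrite eq_sym.
have wit g : exists h, leaf g h \in W.
  have /card_gt1P[x [y [_ _ xy]]] := nH.
  by have [h] := resW g x y xy; rewrite inE; exists h.
have rl g g' h : exists2 z, z \in W & dist (root g) z != dist (leaf g' h) z.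
  case: (eqVneq g' g) => [->|g'g].
    have [g1 g1g] := other g; have [h1 h1W] := wit g1; exists (leaf g1 h1) => //.
    rewrite neq_ltn dist_root_lt // => h'.
    by apply: contra_neq g1g => -[->].
  have [h1 h1W] := wit g; exists (leaf g h1) => //.
  by rewrite dist_root_leaf neq_ltn ltnW // dist_leaf_leaf_gt2.
move=> [g|[g h]] [g'|[g' h']] xy //.
- have gg' : g' != g by apply: contra_neq xy => ->.
  have [h1 h1W] := wit g; exists (leaf g h1) => //.
  by rewrite dist_root_leaf neq_ltn dist_root_leaf_gt1.
- by have [z zW dz] := rl g' g h; exists z; rewrite 1?eq_sym.
case: (eqVneq g' g) xy => [->|g'g] xy.
  have [|z] := resW g h h'; first by apply: contra_neq xy => ->.
  by rewrite inE => zW dz; exists (leaf g z); rewrite ?dist_leaf_same.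
have [h1 h1W] := wit g; exists (leaf g h1) => //.
rewrite dist_leaf_same neq_ltn (leq_ltn_trans _ (dist_leaf_leaf_gt2 _ _ g'g)) //.
by rewrite /tdist; do 2?case: ifP.
Qed.

End Corona.

Lemma K1_connected : connected K1.
Proof. by move=> [] []. Qed.

(** The root, handed to Maker in advance, is at distance 1 from every leaf and separates no two of
    them, so the separating vertex comes from [W]. *)
Lemma adj_resolving_K1 (H : sgraph) (W : {set H}) :
  let f h : corona K1 H := inr (tt, h) in
  resolving (f @: W :|: ~: (f @: setT)) -> adj_resolving W.
Proof.
move=> f resW x y xy.
have [|z] := resW (f x) (f y); first by apply: contra_neq xy => -[].
case: z => [[] _|[[] z]]; first by rewrite !dist_leaf_root ?eqxx //; apply: K1_connected.
rewrite !dist_leaf_same; try exact: K1_connected.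
case/setUP=> [/imsetP[z' zW [->]]|]; first by exists z'.
by rewrite inE (imset_f f (in_setT z)).
Qed.

Theorem theorem3p6 (G H : sgraph)
    (connG : connected G) (connH : connected H)
    (nG : 2 <= #|G|) (nH : 2 <= #|H|)
    (hyp : (has_outcome H outcomeR /\ diam H <= 2) \/
           has_outcome (corona K1 H) outcomeR) :
  has_outcome (corona G H) outcomeR.
Proof.
have winH : maker_wins (@adj_resolving H).
  case: hyp => [[winH d2]|winK].
    apply: maker_wins_weaken (strategy_maker_wins (winH Spoiler)) => W.
    exact: resolving_adj.
  pose f h : corona K1 H := inr (tt, h).
  have f_inj : injective f by move=> x y [].
  have winK2 := strategy_maker_wins (winK Spoiler).
  apply: maker_wins_weaken (maker_wins_subboard f_inj winK2).
  exact: adj_resolving_K1.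
pose leaf g h : corona G H := inr (g, h).
have leaf_inj : injective (fun u : G * H => leaf u.1 u.2).
  by move=> [g h] [g' h'] [-> ->].
(* This vertex only witnesses that the board is inhabited, as the choice of a strategy requires. *)
have /card_gt0P[g _] : 0 < #|G| by apply: ltnW.
move=> first; apply: (maker_wins_strategy (inl g : corona G H)).
apply: maker_wins_weaken (maker_wins_product leaf_inj winH) => W resW.
exact: corona_resolving.
Qed.
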